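(* Let $n\ge3$, let $R$ be the basic braided $R$-matrix of the context, $S=R^{-1}$, $\lambda_1=rs^{-1}$, $\lambda_2=-r^{-1}s$, $\lambda_3=(r^{-1}s)^{2n}$, and let $R_{new}(z)$ be the matrix $$\lambda_1x(x-1)S^{-1}+\Bigl(1+\frac{\lambda_1}{\lambda_2}+\frac{\lambda_1}{\lambda_3}+\frac{\lambda_1^2}{\lambda_2\lambda_3}\Bigr)xI-\frac{\lambda_1}{\lambda_2\lambda_3}(x-1)S,\qquad x=z^{-1},$$ divided by its coefficient at $E_{11}\otimes E_{11}$. Then $R_{new}(\frac zw)$ does not satisfy the intertwining property with respect to the minimal affinizations $T_z$, $T_w$: there exist $x\in U_{r,s}(\widehat{\mathfrak{so}_{2n+1}})$ and basis vectors $v_i\in V(z)$, $v_j\in V(w)$ such that $$R_{new}\Bigl(\frac zw\Bigr)(T_z\otimes T_w)(\Delta(x))(v_i\otimes v_j)\ne(T_w\otimes T_z)(\Delta(x))R_{new}\Bigl(\frac zw\Bigr)(v_i\otimes v_j)$$ as rational functions of $z,w$. That is, $R_{new}(\frac zw)$ is not a module homomorphism $V(z)\otimes V(w)\to V(w)\otimes V(z)$.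
   Context: $r,s$ algebraically independent, $\mathbb K$ an extension of $\mathbb Q(r,s)$ containing $\sqrt r,\sqrt s,\sqrt{r+s}$. $i'=2n+2-i$; $V(z)=V$ has basis $v_1,\dots,v_{2n+1}$; $E_{ij}v_j=v_i$. Coproduct of $U_{r,s}(\widehat{\mathfrak{so}_{2n+1}})$ on its generators ($0\le i\le n$): $\Delta(e_i)=e_i\otimes1+\omega_i\otimes e_i$, $\Delta(f_i)=1\otimes f_i+f_i\otimes\omega_i'$, $\omega_i,\omega_i'$ group-like. $T_z$: for $1\le i\le n-1$, $e_i\mapsto E_{i,i+1}-(rs)^{-1}E_{(i+1)',i'}$, $f_i\mapsto E_{i+1,i}-(rs)^{-1}E_{i',(i+1)'}$, $\omega_i\mapsto r^2E_{ii}+s^2E_{i+1,i+1}+s^{-2}E_{(i+1)',(i+1)'}+r^{-2}E_{i'i'}+\sum_{j\ne i,i+1,i',(i+1)'}E_{jj}$, $\omega_i'\mapsto$ the same with $r\leftrightarrow s$; $e_n\mapsto(r+s)^{1/2}((rs)^{-1/2}E_{n,n+1}-r^{-1}E_{n+1,n'})$, $f_n\mapsto(r+s)^{1/2}((rs)^{-1/2}E_{n+1,n}-s^{-1}E_{n',n+1})$, $\omega_n\mapsto rs^{-1}E_{nn}+E_{n+1,n+1}+r^{-1}sE_{n'n'}+(rs)^{-1}\sum_{j\le n-1}E_{jj}+rs\sum_{j\ge(n-1)'}E_{jj}$, $\omega_n'\mapsto r^{-1}sE_{nn}+E_{n+1,n+1}+rs^{-1}E_{n'n'}+(rs)^{-1}\sum_{j\le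 n-1}E_{jj}+rs\sum_{j\ge(n-1)'}E_{jj}$; $e_0\mapsto-r^{-1/2}s^{-3/2}z(E_{1'2}-rsE_{2'1})$, $f_0\mapsto-r^{-3/2}s^{-1/2}z^{-1}(E_{21'}-rsE_{12'})$, $\omega_0\mapsto s^2E_{11}+r^{-2}E_{22}+(rs)^{-2}\sum_{i=3}^nE_{ii}+E_{n+1,n+1}+s^{-2}E_{1'1'}+r^2E_{2'2'}+(rs)^2\sum_{j=n'}^{3'}E_{jj}$, $\omega_0'\mapsto$ the same with $r\leftrightarrow s$; the central elements $\gamma,\gamma'\mapsto1$. Basic braided $R$-matrix: $\rho_i=\frac{2n+1}2-i$ for $i\le n$, $\rho_{n+1}=0$, $\rho_{i'}=-\rho_i$; $A=\{(i,j):1\le i<j\le n\}\cup\{(i,j):2\le i\le n,(i-1)'\le j\le1'\}$, $B=\{(i,j):1\le i\le n-1,n'\le j\le(i+1)'\}\cup\{(i,j):n'\le i<j\le1'\}$; $R=r^{-1}s\sum_{i\ne i'}E_{ii}\otimes E_{ii}+r^{-1}s^{-1}(\sum_AE_{ij}\otimes E_{ji}+\sum_BE_{ji}\otimes E_{ij})+rs(\sum_AE_{ji}\otimes E_{ij}+\sum_BE_{ij}\otimes E_{ji})+\sum_{i\ne i'}(E_{i,n+1}\otimes E_{n+1,i}+E_{n+1,i}\otimes E_{i,n+1})+rs^{-1}\sum_{i\ne i'}E_{i'i}\otimes E_{ii'}+(r^{-1}s-rs^{-1})\{\sum_{i>j}E_{ii}\otimes E_{jj}-\sum_{i>j}(r^{-1}s)^{\rho_i-\rho_j}E_{ij'}\otimes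 E_{i'j}\}+E_{n+1,n+1}\otimes E_{n+1,n+1}$. *)

(* Defs.v *)
From HB Require Import structures.
From mathcomp Require Import all_boot all_order all_algebra.
From mathcomp Require Export mxtens mpoly.

Set Implicit Arguments.
Unset Strict Implicit.
Unset Printing Implicit Defensive.

Import GRing.Theory.
Local Open Scope ring_scope.

(* Indices i = 1, ..., 2n+1 are kept 1-based, as natural numbers; the ordinal
   k : 'I_(2n+1) stands for the index k+1.  Matrices act on column vectors. *)

Definition prim (n i : nat) : nat := (2 * n + 2 - i)%N.

Definition E (F : fieldType) (n i j : nat) : 'M[F]_((2 * n).+1) :=
  \matrix_(a, b) ((a.+1 == i) && (b.+1 == j))%:R.
Arguments E {F} n i j.

Section Affinization.

(* rh, sh, th are square roots of r, s and r + s; z is the spectral parameter *)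
Variables (F : fieldType) (n : nat) (r s rh sh th z : F).

Local Notation p := (prim n).
Local Notation E := (@E F n).

Definition e_mx (i : nat) : 'M[F]_((2 * n).+1) :=
  if i == 0%N then
    - (rh^-1 * sh ^- 3 * z) *: (E (p 1) 2 - (r * s) *: E (p 2) 1)
  else if (i < n)%N then
    E i i.+1 - (r * s)^-1 *: E (p i.+1) (p i)
  else
    th *: ((rh * sh)^-1 *: E n n.+1 - r^-1 *: E n.+1 (p n)).

Definition f_mx (i : nat) : 'M[F]_((2 * n).+1) :=
  if i == 0%N then
    - (rh ^- 3 * sh^-1 * z^-1) *: (E 2 (p 1) - (r * s) *: E 1 (p 2))
  else if (i < n)%N then
    E i.+1 i - (r * s)^-1 *: E (p i) (p i.+1)
  else
    th *: ((rh * sh)^-1 *: E n.+1 n - s^-1 *: E (p n) n.+1).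

End Affinization.

Definition omega_mx (F : fieldType) (n : nat) (r s : F) (i : nat) :
    'M[F]_((2 * n).+1) :=
  let p := prim n in
  if i == 0%N then
    s ^+ 2 *: E n 1 1 + r ^- 2 *: E n 2 2
    + (r * s) ^- 2 *: (\sum_(3 <= j < n.+1) E n j j)
    + E n n.+1 n.+1
    + s ^- 2 *: E n (p 1) (p 1) + r ^+ 2 *: E n (p 2) (p 2)
    + (r * s) ^+ 2 *: (\sum_(p n <= j < (p 3).+1) E n j j)
  else if (i < n)%N then
    r ^+ 2 *: E n i i + s ^+ 2 *: E n i.+1 i.+1
    + s ^- 2 *: E n (p i.+1) (p i.+1) + r ^- 2 *: E n (p i) (p i)
    + \sum_(1 <= j < (2 * n).+2 | j \notin [:: i; i.+1; p i; p i.+1]) E n j j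
  else
    (r * s^-1) *: E n n n + E n n.+1 n.+1 + (r^-1 * s) *: E n (p n) (p n)
    + (r * s)^-1 *: (\sum_(1 <= j < n) E n j j)
    + (r * s) *: (\sum_(p n.-1 <= j < (2 * n).+2) E n j j).

(* In every case, including i = n, omega'_i is omega_i with r and s swapped. *)
Definition omega'_mx (F : fieldType) (n : nat) (r s : F) (i : nat) :
    'M[F]_((2 * n).+1) :=
  omega_mx n s r i.

(* 2 * rho_i, which is an integer *)
Definition rho2 (n i : nat) : int :=
  if (i <= n)%N then (2 * n + 1)%:Z - (2 * i)%:Z
  else if i == n.+1 then 0
  else - ((2 * n + 1)%:Z - (2 * prim n i)%:Z).

Definition inA (n i j : nat) : bool :=
  [&& 1 <= i, i < j & j <= n]%N
  || [&& 2 <= i, i <= n, prim n i.-1 <= j & j <= prim n 1]%N.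

Definition inB (n i j : nat) : bool :=
  [&& 1 <= i, i <= n.-1, prim n n <= j & j <= prim n i.+1]%N
  || [&& prim n n <= i, i < j & j <= prim n 1]%N.

Definition braidR (F : fieldType) (n : nat) (r s rh sh : F) :
    'M[F]_((2 * n).+1 * (2 * n).+1) :=
  let p := prim n in
  let N := (2 * n).+2 in
  let E := @E F n in
  (r^-1 * s) *: (\sum_(1 <= i < N | i != p i) E i i *t E i i)
  + (r^-1 * s^-1) *:
      (\sum_(1 <= i < N) \sum_(1 <= j < N | inA n i j) E i j *t E j i
       + \sum_(1 <= i < N) \sum_(1 <= j < N | inB n i j) E j i *t E i j)
  + (r * s) *:
      (\sum_(1 <= i < N) \sum_(1 <= j < N | inA n i j) E j i *t E i j
       + \sum_(1 <= i < N) \sum_(1 <= j < N | inB n i j) E i j *t E j i)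
  + \sum_(1 <= i < N | i != p i)
      (E i n.+1 *t E n.+1 i + E n.+1 i *t E i n.+1)
  + (r * s^-1) *: (\sum_(1 <= i < N | i != p i) E (p i) i *t E i (p i))
  + (r^-1 * s - r * s^-1) *:
      (\sum_(1 <= i < N) \sum_(1 <= j < N | (i > j)%N) E i i *t E j j
       (* (r^-1 s)^(rho_i - rho_j), through the square root rh^-1 sh *)
       - \sum_(1 <= i < N) \sum_(1 <= j < N | (i > j)%N)
           (rh^-1 * sh) ^ (rho2 n i - rho2 n j) *: (E i (p j) *t E (p i) j))
  + E n.+1 n.+1 *t E n.+1 n.+1.

Definition Rnew (F : fieldType) (n : nat) (r s rh sh z : F) :
    'M[F]_((2 * n).+1 * (2 * n).+1) :=
  let S := invmx (braidR n r s rh sh) in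
  let l1 := r * s^-1 in
  let l2 := - (r^-1 * s) in
  let l3 := (r^-1 * s) ^+ (2 * n) in
  let x := z^-1 in
  let M := (l1 * x * (x - 1)) *: invmx S
           + ((1 + l1 / l2 + l1 / l3 + l1 ^+ 2 / (l2 * l3)) * x) *: 1%:M
           - (l1 / (l2 * l3) * (x - 1)) *: S in
  let k11 := mxtens_index (ord0, ord0) in
  (M k11 k11)^-1 *: M.

Definition alg_indep2 (K : fieldType) (r s : K) : Prop :=
  forall p : {mpoly rat[2]}, mmap ratr (tnth [tuple r; s]) p = 0 -> p = 0.

(* K(z,w), as the fraction field of K[z,w] *)
Definition ratfun2 (K : fieldType) : fieldType := {fraction {mpoly K[2]}}.
Definition ratfun2C (K : fieldType) (c : K) : ratfun2 K := tofrac c%:MP.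
Definition ratfun2z (K : fieldType) : ratfun2 K :=
  tofrac ('X_(0 : 'I_2) : {mpoly K[2]}).
Definition ratfun2w (K : fieldType) : ratfun2 K :=
  tofrac ('X_(1 : 'I_2) : {mpoly K[2]}).

(* UU, with a |-> a (x) 1 and b |-> 1 (x) b, is the tensor product of K-algebras
   U (x)_K U: the universal ring receiving two commuting copies of U that agree
   on K. *)
Definition is_tensor_square (K : fieldType) (U UU : algType K)
    (inl inr : {lrmorphism U -> UU}) : Prop :=
  (forall a b, inl a * inr b = inr b * inl a) /\
  forall (A : pzRingType) (f g : {rmorphism U -> A}),
    (forall c : K, f c%:A = g c%:A) ->
    (forall a b, f a * g b = g b * f a) ->
    (exists h : {rmorphism UU -> A}, forall a b, h (inl a * inr b) = f a * g b)
    /\ (forall h h' : {rmorphism UU -> A},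
          (forall a b, h (inl a * inr b) = f a * g b) ->
          (forall a b, h' (inl a * inr b) = f a * g b) -> h =1 h').

(* Generators and coproduct of U_{r,s}(so_{2n+1}^), U (x) U being aff_alg2.  Among
   the defining relations only the centrality of gamma and gamma' is required
   (the others are not used), so U_{r,s}(so_{2n+1}^) is an instance of this
   structure, whichever of its presentations is chosen. *)
Record affine_algebra (K : fieldType) (n : nat) := AffineAlgebra {
  aff_alg :> algType K;
  ge : 'I_n.+1 -> aff_alg;
  gf : 'I_n.+1 -> aff_alg;
  gomega : 'I_n.+1 -> aff_alg;
  gomega' : 'I_n.+1 -> aff_alg;
  ggamma : aff_alg;
  ggamma' : aff_alg;
  ggammaC : forall x : aff_alg, ggamma * x = x * ggamma;
  ggamma'C : forall x : aff_alg, ggamma' * x = x * ggamma';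
  aff_alg2 : algType K;
  tensl : {lrmorphism aff_alg -> aff_alg2};
  tensr : {lrmorphism aff_alg -> aff_alg2};
  tensP : is_tensor_square tensl tensr;
  Delta : {lrmorphism aff_alg -> aff_alg2};
  Delta_e : forall i, Delta (ge i) =
    tensl (ge i) * tensr 1 + tensl (gomega i) * tensr (ge i);
  Delta_f : forall i, Delta (gf i) =
    tensl 1 * tensr (gf i) + tensl (gf i) * tensr (gomega' i);
  Delta_omega : forall i, Delta (gomega i) =
    tensl (gomega i) * tensr (gomega i);
  Delta_omega' : forall i, Delta (gomega' i) =
    tensl (gomega' i) * tensr (gomega' i)
}.

(* T is the representation T_u of U on V(u), extended to K(z,w). *)
Definition is_minimal_affinization (K : fieldType) (n : nat)
    (r s rh sh th : K) (U : affine_algebra K n) (u : ratfun2 K)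
    (T : {rmorphism U -> 'M[ratfun2 K]_((2 * n).+1)}) : Prop :=
  let c := @ratfun2C K in
  (forall a : K, T a%:A = (c a)%:M) /\
  [/\ forall i, T (ge U i) = e_mx n (c r) (c s) (c rh) (c sh) (c th) u i,
      forall i, T (gf U i) = f_mx n (c r) (c s) (c rh) (c sh) (c th) u i,
      forall i, T (gomega U i) = omega_mx n (c r) (c s) i,
      forall i, T (gomega' U i) = omega'_mx n (c r) (c s) i &
      T (ggamma U) = 1 /\ T (ggamma' U) = 1].

(* T12 = T1 (x) T2; this determines T12, as U (x) U is spanned by pure tensors *)
Definition is_tensor_rep (K : fieldType) (n : nat) (U : affine_algebra K n)
    (T1 T2 : {rmorphism U -> 'M[ratfun2 K]_((2 * n).+1)})
    (T12 : {rmorphism aff_alg2 U ->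
              'M[ratfun2 K]_((2 * n).+1 * (2 * n).+1)}) : Prop :=
  forall a b : U, T12 (tensl U a * tensr U b) = T1 a *t T2 b.

Definition basis_vec (F : fieldType) (n : nat) (i : 'I_((2 * n).+1)) :
    'cV[F]_((2 * n).+1) :=
  delta_mx i 0.

(* Main.v *)
(** Let q = r^-1 s.  The vector omega = sum_k q^(rho_k) v_k (x) v_k' spans the
    trivial summand of V (x) V and satisfies R omega = q^(-2n) omega, whereas
    Delta(e_0) sends it to a multiple, affine in z and w, of a vector
    u = q^(-1/2) v_1' (x) v_2' - r s q^(1/2) v_2' (x) v_1' with R u = - q^-1 u.
    An intertwiner that is a function of R would therefore have a prescribed
    ratio of eigenvalues at u and omega, and that of R_new differs from it,
    because w/z is transcendental and q is not a root of unity. *)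

Require Import Defs.
From HB Require Import structures.
From mathcomp Require Import all_boot all_order all_algebra.
From mathcomp Require Import zify ring.

Set Implicit Arguments.
Unset Strict Implicit.
Unset Printing Implicit Defensive.

Import GRing.Theory.
Local Open Scope ring_scope.

(** * Consequences of algebraic independence *)

Section AlgIndep.

Variables (K : fieldType) (r s : K).
Hypothesis rs_indep : alg_indep2 r s.

(* [mmap] is only known to be additive for an additive coefficient map, and
   [ratr] is not one for an arbitrary [K]; hence the explicit support. *)
Lemma mmap_ratr_subXn (a b : 'X_{1..2}) (h : 'I_2 -> K) : a != b ->
  mmap ratr h ('X_[a] - 'X_[b] : {mpoly rat[2]}) = mmap1 h a - mmap1 h b.
Proof.
move=> nab; rewrite /mmap (perm_big [:: a; b]) /=; last first.
  apply: uniq_perm; rewrite ?msupp_uniq //= ?inE ?nab // => x.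
  rewrite mcoeff_msupp mcoeffB !mcoeffX !inE ![x == _]eq_sym.
  have [<-|_] := eqVneq a x; first by rewrite [b == a]eq_sym (negbTE nab) subr0 oner_eq0.
  by case: (b == x) => /=; rewrite ?sub0r ?subr0 ?oppr_eq0 ?oner_eq0 ?eqxx.
rewrite big_cons big_seq1 !mcoeffB !mcoeffX !eqxx (negbTE nab).
rewrite [b == a]eq_sym (negbTE nab) subr0 sub0r (ratr_int _ 1) (ratr_int _ (-1)).
by rewrite mul1r mulN1r.
Qed.

(** If r or s vanished, the corresponding variable would itself be an algebraic relation. *)
Lemma alg_indep2_neq0 : (r != 0) * (s != 0).
Proof.
have mX (i : 'I_2) : mmap ratr (tnth [tuple r; s]) ('X_i : {mpoly rat[2]})
    = tnth [tuple r; s] i.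
  by rewrite /mmap msuppX big_seq1 mcoeffX eqxx (ratr_int _ 1) mul1r mmap1U.
split; apply/negP => /eqP x0.
- have /(congr1 (mcoeff U_(0%R))) := rs_indep (etrans (mX 0) x0).
  by rewrite mcoeffXU mcoeff0 eqxx => /eqP; rewrite oner_eq0.
- have /(congr1 (mcoeff U_(1%R))) := rs_indep (etrans (mX 1) x0).
  by rewrite mcoeffXU mcoeff0 eqxx => /eqP; rewrite oner_eq0.
Qed.

(** With q = r^-1 s, the equality q^k = 1 would make X_0^k - X_1^k a relation between r and s. *)
Lemma alg_indep2_expn_neq1 k : (0 < k)%N -> (r^-1 * s) ^+ k != 1.
Proof.
move=> k_gt0; have [r0 s0] := alg_indep2_neq0.
have nab : (U_(0%R : 'I_2) *+ k)%MM != (U_(1%R : 'I_2) *+ k)%MM.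
  apply/eqP => /(congr1 (fun m : 'X_{1..2} => m 0)).
  by rewrite !mulmnE !mnm1E /= => ?; lia.
apply/negP => /eqP sk.
have m1E i : mmap1 (tnth [tuple r; s]) (U_(i) *+ k)%MM = tnth [tuple r; s] i ^+ k.
  rewrite /mmap1 (bigD1 i) //= big1 ?mulr1 => [|j ji].
    by rewrite mulmnE mnm1E (eqxx i) mul1n.
  by rewrite mulmnE mnm1E eq_sym (negbTE ji).
have := rs_indep (etrans (mmap_ratr_subXn _ nab) _).
rewrite !m1E /= -[X in X - _]mulr1 -sk exprMn exprVn mulrA.
rewrite divff ?expf_neq0 // mul1r subrr => /(_ erefl).
(* The coefficient at X_0^k is 1, since the two monomials differ. *)
move/(congr1 (mcoeff (U_(0%R) *+ k)%MM)).
rewrite mcoeffB !mcoeffX eqxx [X in _ - (nat_of_bool X)%:R]eq_sym (negbTE nab).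
rewrite mcoeff0 subr0.
by move/eqP; rewrite oner_eq0.
Qed.

End AlgIndep.

(** * Constants and variables in K(z,w) *)

Section RatFun.

Variable K : fieldType.

Local Notation C := (@ratfun2C K).
Local Notation z := (ratfun2z K).
Local Notation w := (ratfun2w K).

Lemma ratfun2z_neq0 : z != 0.
Proof.
rewrite tofrac_eq0; apply/eqP => /(congr1 (mcoeff U_(0%R))).
by rewrite mcoeffXU mcoeff0 eqxx => /eqP; rewrite oner_eq0.
Qed.

(** This is the form in which the transcendence of w/z over K is used: a vanishing quadratic form in
    z and w has no w^2 term. *)
Lemma ratfun2w_quadratic (a b c : K) :
  C a * z ^+ 2 + C b * z * w + C c * w ^+ 2 = 0 -> c = 0.
Proof.
rewrite /ratfun2C /ratfun2z /ratfun2w -!rmorphXn -!rmorphM -!rmorphD /=.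
move/eqP; rewrite tofrac_eq0.
(* Evaluation at z = 0, w = 1 leaves only c. *)
move/eqP/(congr1 (meval (fun i : 'I_2 => (i == 1)%:R))).
rewrite !mevalD !mevalM !mevalC !mevalXU /= raddf0.
by rewrite !mulr0 mul0r !add0r !mulr1.
Qed.

Lemma ratfun2C_is_zmod_morphism : zmod_morphism C.
Proof. by move=> a b; rewrite /ratfun2C !rmorphB. Qed.

Lemma ratfun2C_is_monoid_morphism : monoid_morphism C.
Proof. by split=> [|a b]; rewrite /ratfun2C ?rmorph1 ?rmorphM. Qed.

End RatFun.

HB.instance Definition _ (K : fieldType) :=
  GRing.isZmodMorphism.Build K (ratfun2 K) (@ratfun2C K)
    (@ratfun2C_is_zmod_morphism K).
HB.instance Definition _ (K : fieldType) :=
  GRing.isMonoidMorphism.Build K (ratfun2 K) (@ratfun2C K)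
    (@ratfun2C_is_monoid_morphism K).

(** * The braided R-matrix on tensor basis vectors *)

Section BraidAction.

Variables (F : fieldType) (n : nat).
Local Notation p := (prim n).
Local Notation N := ((2 * n).+2).
Local Notation E := (@E F n).

Definition in_range (k : nat) := (0 < k < N)%N.

(** Indexed from 1 to match [E]. An index outside 1, ..., 2n+1 gives the zero vector, which is why
    [in_range] accompanies it. *)
Definition ecol (k : nat) : 'cV[F]_((2 * n).+1) := \col_a (a.+1 == k)%:R.

Definition ecol2 (c d : nat) := ecol c *t ecol d.

Lemma E_ecol i j k : in_range k -> E i j *m ecol k = (j == k)%:R *: ecol i.
Proof.
case/andP=> k0 kN; apply/matrixP => a b; rewrite !mxE.
have k1 : (k.-1 < (2 * n).+1)%N by lia.
rewrite (bigD1 (Ordinal k1)) //= big1 ?addr0 => [|x nx].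
  by rewrite !mxE /= prednK // eqxx mulr1 [k == j]eq_sym -natrM mulnb andbC -mulnb natrM.
rewrite !mxE; have -> : (x.+1 == k) = false; last by rewrite mulr0.
by apply/negP => /eqP xk; case/eqP: nx; apply: val_inj; rewrite /= -xk.
Qed.

Lemma tensmxZl (m1 m2 m3 m4 : nat) (a : F) (A : 'M_(m1, m2)) (B : 'M_(m3, m4)) :
  (a *: A) *t B = a *: (A *t B).
Proof. by apply/matrixP => i j; rewrite !mxE mulrA. Qed.

Lemma tensmxZr (m1 m2 m3 m4 : nat) (a : F) (A : 'M_(m1, m2)) (B : 'M_(m3, m4)) :
  A *t (a *: B) = a *: (A *t B).
Proof. by apply/matrixP => i j; rewrite !mxE mulrCA. Qed.

Lemma tensmxBl (m1 m2 m3 m4 : nat) (A B : 'M[F]_(m1, m2)) (C : 'M_(m3, m4)) :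
  (A - B) *t C = A *t C - B *t C.
Proof. by apply/matrixP => i j; rewrite !mxE mulrBl. Qed.

Lemma tensmxBr (m1 m2 m3 m4 : nat) (A : 'M[F]_(m1, m2)) (B C : 'M_(m3, m4)) :
  A *t (B - C) = A *t B - A *t C.
Proof. by apply/matrixP => i j; rewrite !mxE mulrBr. Qed.

Lemma E2_ecol2 i j k l c d : in_range c -> in_range d ->
  (E i j *t E k l) *m ecol2 c d = ((j == c) && (l == d))%:R *: ecol2 i k.
Proof.
move=> cN dN; rewrite /ecol2 tensmx_mul !E_ecol // tensmxZl tensmxZr scalerA.
by rewrite -natrM mulnb.
Qed.

(** The coefficient has the shape produced by [E2_ecol2]: one equation pins the summation index to
    c, and the other becomes a condition Q on it. *)
Lemma sum_nat_delta (V : lmodType F) (P Q : pred nat) (G : nat -> V) c :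
  in_range c ->
  \sum_(1 <= i < N | P i) ((i == c) && Q i)%:R *: G i = (P c && Q c)%:R *: G c.
Proof.
move=> cN; rewrite (eq_bigr (fun i => if i == c then (Q c)%:R *: G c else 0)).
  rewrite -big_mkcondr big_nat1_cond_eq -/(in_range c) cN /=.
  by case: (P c); rewrite ?scale0r.
by move=> i _; case: eqP => [->|] //=; rewrite scale0r.
Qed.

Lemma sum2_nat_delta (V : lmodType F) (P : rel nat) (G : nat -> nat -> V) c d :
  in_range c -> in_range d ->
  \sum_(1 <= i < N) \sum_(1 <= j < N | P i j) ((i == c) && (j == d))%:R *: G i j
  = (P c d)%:R *: G c d.
Proof.
move=> cN dN; transitivity
  (\sum_(1 <= i < N) ((i == c) && xpredT i)%:R *: ((P i d)%:R *: G i d)).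
  apply: eq_bigr => i _; rewrite andbT; case: eqP => [_|_] /=; last first.
    by rewrite scale0r big1 // => j _; rewrite scale0r.
  rewrite scale1r -[P i d]andbT -(sum_nat_delta (P i) xpredT) //.
  by apply: eq_bigr => j _; rewrite andbT.
by rewrite sum_nat_delta //= scale1r.
Qed.

Lemma primK k : in_range k -> p (p k) = k.
Proof. by rewrite /in_range /prim; lia. Qed.

Lemma prim_range k : in_range k -> in_range (p k).
Proof. by rewrite /in_range /prim; lia. Qed.

Lemma prim_eq j k : in_range j -> in_range k -> (p j == k) = (j == p k).
Proof. by rewrite /in_range /prim; lia. Qed.

Variables (r s rh sh : F).

(** In every sum of R except the last, v_c (x) v_d selects at most one term, which either fixes it
    or flips it to v_d (x) v_c. In the last sum it forces j = d and c = d', leaving a sum over all i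
    > d. *)
Lemma braidR_ecol2 c d : in_range c -> in_range d ->
  braidR n r s rh sh *m ecol2 c d =
  (r^-1 * s * ((c != p c) && (c == d))%:R
   + (r^-1 * s - r * s^-1) * (d < c)%:R
   + ((c == n.+1) && (d == n.+1))%:R) *: ecol2 c d
  + (r^-1 * s^-1 * ((inA n d c)%:R + (inB n c d)%:R)
     + r * s * ((inA n c d)%:R + (inB n d c)%:R)
     + (((d != p d) && (c == n.+1))%:R + ((c != p c) && (d == n.+1))%:R)
     + r * s^-1 * ((c != p c) && (d == p c))%:R) *: ecol2 d c
  - ((r^-1 * s - r * s^-1) * (c == p d)%:R) *:
    \sum_(1 <= i < N | (d < i)%N)
       (rh^-1 * sh) ^ (rho2 n i - rho2 n d) *: ecol2 i (p i).
Proof.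
move=> cN dN.
have S1 : (\sum_(1 <= i < N | i != p i) E i i *t E i i) *m ecol2 c d
    = ((c != p c) && (c == d))%:R *: ecol2 c d.
  rewrite mulmx_suml -(sum_nat_delta (fun i => i != p i) (fun i => i == d)
    (fun i => ecol2 i d)) //.
  apply: eq_bigr => i _; rewrite E2_ecol2 //.
  by case: (i =P d) => [->|]; rewrite ?andbF ?scale0r.
have SA (P : rel nat) :
    (\sum_(1 <= i < N) \sum_(1 <= j < N | P i j) E i j *t E j i) *m ecol2 c d
    = (P d c)%:R *: ecol2 d c.
  rewrite -sum2_nat_delta // mulmx_suml; apply: eq_bigr => i _.
  by rewrite mulmx_suml; apply: eq_bigr => j _; rewrite E2_ecol2 // andbC.
have SB (P : rel nat) :
    (\sum_(1 <= i < N) \sum_(1 <= j < N | P i j) E j i *t E i j) *m ecol2 c d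
    = (P c d)%:R *: ecol2 d c.
  rewrite -(sum2_nat_delta _ (fun i j => ecol2 j i)) // mulmx_suml.
  apply: eq_bigr => i _.
  by rewrite mulmx_suml; apply: eq_bigr => j _; rewrite E2_ecol2.
have Smid : (\sum_(1 <= i < N | i != p i)
      (E i n.+1 *t E n.+1 i + E n.+1 i *t E i n.+1)) *m ecol2 c d
    = (((d != p d) && (c == n.+1))%:R + ((c != p c) && (d == n.+1))%:R)
      *: ecol2 d c.
  rewrite big_split mulmxDl scalerDl !mulmx_suml; congr (_ + _).
    transitivity (((d != p d) && (c == n.+1))%:R *: ecol2 d n.+1); last first.
      by case: (c =P n.+1) => [->|]; rewrite ?andbF ?scale0r.
    rewrite -(sum_nat_delta (fun i => i != p i) (fun i => c == n.+1)
      (fun i => ecol2 i n.+1)) //.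
    by apply: eq_bigr => i _; rewrite E2_ecol2 // andbC [n.+1 == c]eq_sym.
  transitivity (((c != p c) && (d == n.+1))%:R *: ecol2 n.+1 c); last first.
    by case: (d =P n.+1) => [->|]; rewrite ?andbF ?scale0r.
  rewrite -(sum_nat_delta (fun i => i != p i) (fun i => d == n.+1)
    (fun i => ecol2 n.+1 i)) //.
  by apply: eq_bigr => i _; rewrite E2_ecol2 // [n.+1 == d]eq_sym.
have Sop : (\sum_(1 <= i < N | i != p i) E (p i) i *t E i (p i)) *m ecol2 c d
    = ((c != p c) && (d == p c))%:R *: ecol2 d c.
  transitivity (((c != p c) && (d == p c))%:R *: ecol2 (p c) c); last first.
    by case: (d =P p c) => [->|]; rewrite ?andbF ?scale0r.
  rewrite mulmx_suml -(sum_nat_delta (fun i => i != p i) (fun i => d == p i)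
    (fun i => ecol2 (p i) i)) //.
  by apply: eq_bigr => i _; rewrite E2_ecol2 // [_ == d]eq_sym.
have Slt : (\sum_(1 <= i < N) \sum_(1 <= j < N | (i > j)%N) E i i *t E j j)
    *m ecol2 c d = (d < c)%:R *: ecol2 c d.
  rewrite -(sum2_nat_delta (fun i j => j < i)%N) // mulmx_suml.
  apply: eq_bigr => i _.
  by rewrite mulmx_suml; apply: eq_bigr => j _; rewrite E2_ecol2.
have Srho : (\sum_(1 <= i < N) \sum_(1 <= j < N | (i > j)%N)
      (rh^-1 * sh) ^ (rho2 n i - rho2 n j) *: (E i (p j) *t E (p i) j))
    *m ecol2 c d = (c == p d)%:R *: \sum_(1 <= i < N | (d < i)%N)
       (rh^-1 * sh) ^ (rho2 n i - rho2 n d) *: ecol2 i (p i).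
  rewrite mulmx_suml scaler_sumr [RHS]big_mkcond; apply: eq_bigr => i _.
  rewrite mulmx_suml.
  transitivity (((d < i)%N && (c == p d))%:R *:
    ((rh^-1 * sh) ^ (rho2 n i - rho2 n d) *: ecol2 i (p i))); last first.
    by case: (d < i)%N; rewrite ?scale0r.
  rewrite -(sum_nat_delta (fun j => j < i)%N (fun j => c == p j)
    (fun j => (rh^-1 * sh) ^ (rho2 n i - rho2 n j) *: ecol2 i (p i))) //.
  apply: eq_bigr => j _; rewrite -scalemxAl E2_ecol2 // scalerA mulrC -scalerA.
  by rewrite andbC [p j == c]eq_sym.
rewrite /braidR; rewrite !(mulmxDl, mulNmx) -!scalemxAl.
rewrite !(mulmxDl, mulNmx) S1 !SA !SB Smid Sop Slt Srho E2_ecol2 //.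
have -> : ((n.+1 == c) && (n.+1 == d))%:R *: ecol2 n.+1 n.+1
    = ((c == n.+1) && (d == n.+1))%:R *: ecol2 c d.
  rewrite [n.+1 == c]eq_sym [n.+1 == d]eq_sym.
  by case: eqP => [->|_]; case: eqP => [->|_]; rewrite ?scale0r.
move: (ecol2 c d) (ecol2 d c) (\sum_(_ <= _ < _ | _) _) => X Y W.
apply/matrixP => i j; rewrite !mxE; ring.
Qed.

End BraidAction.

(** * Eigenvectors of the R-matrix *)

Lemma rho2_prim n k : in_range n k -> rho2 n (prim n k) = - rho2 n k.
Proof.
rewrite /in_range /rho2 /prim => kN.
by do !case: ifPn; rewrite -?[(_ == _)]/(_ == _ :> nat) => *; lia.
Qed.

Lemma sum_prim (V : nmodType) n (G : nat -> V) :
  \sum_(1 <= k < (2 * n).+2) G k = \sum_(1 <= k < (2 * n).+2) G (prim n k).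
Proof.
rewrite big_nat_rev; apply: eq_big_nat => k kN.
by congr G; rewrite /prim; lia.
Qed.

(** The sum telescopes: for k <= n the k-th term is the increment of q^(2k-2n-2) from k to k+1, and
    for k > n+1 that of q^(2k-2n-4). The middle index, where rho vanishes, contributes the extra q -
    q^-1. *)
Lemma sum_expz_rho2 (F : fieldType) (q : F) n i : q != 0 -> in_range n i ->
  \sum_(1 <= k < i) (q - q^-1) * q ^ (- rho2 n k)
  = (if (i <= n.+1)%N then q ^ (2 * i%:Z - 2 - 2 * n%:Z)
     else q ^ (2 * i%:Z - 2 * n%:Z - 4) + q - q^-1) - q ^ (- (2 * n%:Z)).
Proof.
move=> q0; elim: i => [|i IHi] // iN.
have [->|i0] := posnP i.
  rewrite big_geq //.
  have -> : 2 * 1%:Z - 2 - 2 * n%:Z = - (2 * n%:Z) by lia.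
  by rewrite subrr.
rewrite big_nat_recr //= IHi; last by move: iN; rewrite /in_range; lia.
have qD a b c : a = b + c -> q ^ a = q ^ b * q ^ c by move=> ->; exact: expfzDr.
rewrite /rho2; have [i_n|n_i] := leqP i n.
  have -> : (i <= n.+1)%N by lia.
  have -> : (i.+1 <= n.+1)%N by lia.
  rewrite (qD (2 * i%:Z - 2 - 2 * n%:Z) (2 * i%:Z - 1 - 2 * n%:Z) (-1)) ?exprN1;
    last by lia.
  have -> : - ((2 * n + 1)%:Z - (2 * i)%:Z) = 2 * i%:Z - 1 - 2 * n%:Z by lia.
  rewrite (qD (2 * i.+1%:Z - 2 - 2 * n%:Z) (2 * i%:Z - 1 - 2 * n%:Z) 1); last by lia.
  by rewrite expr1z; ring.
have -> : (i.+1 <= n.+1)%N = false by lia.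
(* The closed form changes branch when the middle term is added. *)
have [->|ni] := eqVneq i n.+1.
  rewrite leqnn oppr0 expr0z.
  have -> : 2 * n.+1%:Z - 2 - 2 * n%:Z = 0 by lia.
  have -> : 2 * n.+2%:Z - 2 * n%:Z - 4 = 0 by lia.
  by rewrite expr0z; ring.
have -> : (i <= n.+1)%N = false by lia.
have iN' : (i <= 2 * n + 2)%N by move: iN; rewrite /in_range; lia.
rewrite (qD (2 * i%:Z - 2 * n%:Z - 4) (2 * i%:Z - 3 - 2 * n%:Z) (-1)) ?exprN1;
  last by lia.
have -> : - - ((2 * n + 1)%:Z - (2 * prim n i)%:Z) = 2 * i%:Z - 3 - 2 * n%:Z.
  by rewrite /prim; lia.
rewrite (qD (2 * i.+1%:Z - 2 * n%:Z - 4) (2 * i%:Z - 3 - 2 * n%:Z) 1); last by lia.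
by rewrite expr1z; ring.
Qed.

Section Eigenvectors.

Variables (F : fieldType) (n : nat) (r s rh sh : F).
Hypotheses (n_gt1 : (1 < n)%N) (rhE : rh ^+ 2 = r) (shE : sh ^+ 2 = s).
Hypotheses (r0 : r != 0) (s0 : s != 0).

Local Notation p := (prim n).
Local Notation N := ((2 * n).+2).
Local Notation R := (braidR n r s rh sh).
Local Notation q := (r^-1 * s).
Local Notation h := (rh^-1 * sh).
Local Notation ecol := (@ecol F n).
Local Notation ecol2 := (@ecol2 F n).

Let rh0 : rh != 0. Proof. by move: r0; rewrite -rhE expf_eq0. Qed.
Let sh0 : sh != 0. Proof. by move: s0; rewrite -shE expf_eq0. Qed.
Let h0 : h != 0. Proof. by rewrite mulf_neq0 ?invr_eq0. Qed.
Let q0 : q != 0. Proof. by rewrite mulf_neq0 ?invr_eq0. Qed.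
Let h2 : h ^ (2 : int) = q.
Proof. by rewrite -rhE -shE -exprVn -exprMn. Qed.

(** This eigenvalue determines the coefficient by which R_new is normalised. *)
Lemma braidR_ecol11 : R *m ecol2 1 1 = q *: ecol2 1 1.
Proof.
rewrite braidR_ecol2 ?/in_range //.
have -> : inA n 1 1 = false by rewrite /inA /prim; lia.
have -> : inB n 1 1 = false by rewrite /inB /prim; lia.
have -> : (1 == p 1)%N = false by rewrite /prim; lia.
have -> : (1 == n.+1)%N = false by lia.
by rewrite /= !(mulr0, mulr1, addr0, scale0r, subr0).
Qed.

(** The vector u, with h in the role of q^(1/2). *)
Definition alt_vec : 'M[F]_((2 * n).+1 * (2 * n).+1, 1 * 1) :=
  h^-1 *: ecol2 (p 1) (p 2) - (r * s * h) *: ecol2 (p 2) (p 1).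

(** R preserves the span of the two basis tensors involved, with trace q - q^-1 and determinant -1
    there. Its eigenvalues on that plane are therefore q and -q^-1. *)
Lemma braidR_alt_vec : R *m alt_vec = (- q^-1) *: alt_vec.
Proof.
rewrite mulmxBr -!scalemxAr !braidR_ecol2; try by rewrite /in_range /prim; lia.
have -> : inA n (p 1) (p 2) = false by rewrite /inA /prim; lia.
have -> : inA n (p 2) (p 1) = false by rewrite /inA /prim; lia.
have -> : inB n (p 1) (p 2) = false by rewrite /inB /prim; lia.
have -> : inB n (p 2) (p 1) = true by rewrite /inB /prim; lia.
rewrite !primK /in_range; try lia.
have -> : (p 1 == p 2)%N = false by rewrite /prim; lia.
have -> : (p 2 == p 1)%N = false by rewrite /prim; lia.
have -> : (p 1 == n.+1)%N = false by rewrite /prim; lia.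
have -> : (p 2 == n.+1)%N = false by rewrite /prim; lia.
have -> : (p 2 == 1)%N = false by rewrite /prim; lia.
have -> : (p 1 == 2)%N = false by rewrite /prim; lia.
have -> : (p 1 < p 2)%N = false by rewrite /prim; lia.
have -> : (p 2 < p 1)%N = true by rewrite /prim; lia.
rewrite !andbF /= !(mulr0, mulr1, add0r, addr0, scale0r, subr0) /alt_vec.
move: (ecol2 _ _) (ecol2 _ _) => X Y; rewrite -rhE -shE.
by apply/matrixP => i j; rewrite !mxE; field; rewrite rh0 sh0.
Qed.

(** The vector omega: h^(2 rho_k) is q^(rho_k). *)
Definition inv_vec : 'M[F]_((2 * n).+1 * (2 * n).+1, 1 * 1) :=
  \sum_(1 <= k < N) h ^ rho2 n k *: ecol2 k (p k).

(** Neither A nor B contains a pair (k,k'), so their sums drop out. The condition k' < i is written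
    as a coefficient so that the sum runs over the full range and can later be exchanged with a sum
    over k. *)
Lemma braidR_ecol2_prim k : in_range n k ->
  R *m ecol2 k (p k) =
  ((q - q^-1) * (n.+1 < k)%:R + (k == n.+1)%:R) *: ecol2 k (p k)
  + (q^-1 * (k != n.+1)%:R) *: ecol2 (p k) k
  - (q - q^-1) *: \sum_(1 <= i < N)
      ((p k < i)%:R * (h ^ rho2 n i * h ^ rho2 n k)) *: ecol2 i (p i).
Proof.
move=> kN; rewrite braidR_ecol2 ?prim_range // primK //.
have -> : inA n k (p k) = false by move: kN; rewrite /in_range /inA /prim; lia.
have -> : inA n (p k) k = false by move: kN; rewrite /in_range /inA /prim; lia.
have -> : inB n k (p k) = false by move: kN; rewrite /in_range /inB /prim; lia.
have -> : inB n (p k) k = false by move: kN; rewrite /in_range /inB /prim; lia.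
have -> : (k != p k) && (k == p k) = false by case: eqP.
have -> : (k == n.+1) && (p k == n.+1) = (k == n.+1).
  by move: kN; rewrite /in_range /prim; lia.
have -> : (p k != k) && (k == n.+1) = false.
  by move: kN; rewrite /in_range /prim; lia.
have -> : (k != p k) && (p k == n.+1) = false.
  by move: kN; rewrite /in_range /prim; lia.
have -> : (k != p k) && (p k == p k) = (k != n.+1).
  by move: kN; rewrite /in_range /prim; lia.
have -> : (p k < k)%N = (n.+1 < k)%N.
  by move: kN; rewrite /in_range /prim; lia.
rewrite eqxx mulr1 /= !(mulr0, addr0, add0r) invfM invrK; congr (_ - _ *: _).
rewrite big_mkcond; apply: eq_bigr => i _.
rewrite rho2_prim // opprK expfzDr //.
by case: ifP => _; rewrite ?mul1r ?mul0r ?scale0r.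
Qed.

(** In the coefficient of v_i (x) v_i', the diagonal and flip terms cancel the upper end of the
    telescoping sum of [sum_expz_rho2]; its lower end q^(-2n) remains and is the eigenvalue. *)
Lemma braidR_inv_vec : R *m inv_vec = (q ^+ (2 * n))^-1 *: inv_vec.
Proof.
rewrite /inv_vec mulmx_sumr scaler_sumr.
transitivity (\sum_(1 <= k < N)
   (h ^ rho2 n k * ((q - q^-1) * (n.+1 < k)%:R + (k == n.+1)%:R))
     *: ecol2 k (p k)
 + \sum_(1 <= k < N) (h ^ rho2 n k * (q^-1 * (k != n.+1)%:R)) *: ecol2 (p k) k
 - \sum_(1 <= k < N) \sum_(1 <= i < N)
     (h ^ rho2 n k * ((q - q^-1) * ((p k < i)%:R * (h ^ rho2 n i * h ^ rho2 n k))))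
      *: ecol2 i (p i)).
  rewrite -big_split -sumrB; apply: eq_big_nat => k kN.
  rewrite -scalemxAr braidR_ecol2_prim // scalerBr scalerDr !scalerA.
  congr (_ - _); rewrite scaler_sumr; apply: eq_bigr => i _.
  by rewrite !scalerA; congr (_ *: _); ring.
(* Substituting k' for k turns the flipped vectors back into v_k (x) v_k' and the condition k' < i
   into k < i. *)
rewrite [X in _ + X - _]sum_prim [X in _ - X]sum_prim exchange_big.
rewrite -big_split -sumrB; apply: eq_big_nat => i iN /=.
rewrite primK // rho2_prim // -scaler_suml -scalerDl -scalerBl scalerA.
congr (_ *: _).
have -> : \sum_(1 <= k < N) h ^ rho2 n (p k) *
    ((q - q^-1) * ((p (p k) < i)%:R * (h ^ rho2 n i * h ^ rho2 n (p k))))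
  = h ^ rho2 n i * \sum_(1 <= k < i) (q - q^-1) * q ^ (- rho2 n k).
  rewrite mulr_sumr (@big_nat_widen _ _ _ 1 i N); last by case/andP: iN => _ /ltnW.
  rewrite [RHS]big_mkcond /=; apply: eq_big_nat => k kN.
  rewrite primK // rho2_prim //; case: ifP => _; last by rewrite !(mul0r, mulr0).
  rewrite mul1r -h2 exprz_exp.
  have -> : h ^ (2 * - rho2 n k) = h ^ (- rho2 n k) * h ^ (- rho2 n k).
    by rewrite -expfzDr //; congr (_ ^ _); ring.
  by ring.
rewrite sum_expz_rho2 //.
have -> : h ^ (- rho2 n i) = h ^ rho2 n i * q ^ (- rho2 n i).
  by rewrite -h2 exprz_exp -expfzDr //; congr (_ ^ _); ring.
have -> : q ^ (- (2 * n%:Z)) = (q ^+ (2 * n))^-1 by rewrite -invr_expz.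
have -> : (p i != n.+1) = (i != n.+1).
  by move: iN; rewrite /in_range /prim; lia.
have qD a b c : a = b + c -> q ^ a = q ^ b * q ^ c by move=> ->; exact: expfzDr.
have [i_n|n_i|->] := ltngtP i n.+1.
- rewrite /rho2 ifT //.
  rewrite (qD (2 * i%:Z - 2 - 2 * n%:Z) (- ((2 * n + 1)%:Z - (2 * i)%:Z)) (-1)).
    by rewrite exprN1 /= !(mulr0, mulr1, addr0, add0r); ring.
  by lia.
- rewrite /rho2 ifN -?ltnNge; last by lia.
  rewrite gtn_eqF // opprK.
  rewrite (qD (2 * i%:Z - 2 * n%:Z - 4)
     ((2 * n + 1)%:Z - (2 * p i)%:Z) (-1)).
    by rewrite exprN1 /= !(mulr0, mulr1, addr0, add0r); ring.
  by move: iN; rewrite /in_range /prim; lia.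
- have -> : 2 * n.+1%:Z - 2 - 2 * n%:Z = 0 by lia.
  by rewrite expr0z /=; ring.
Qed.

End Eigenvectors.

(** * The action of e_0 *)

Section Raising.

Variables (F : fieldType) (n : nat) (r s rh sh th : F).
Hypotheses (n_gt2 : (2 < n)%N) (rhE : rh ^+ 2 = r) (shE : sh ^+ 2 = s).
Hypotheses (r0 : r != 0) (s0 : s != 0).

Local Notation p := (prim n).
Local Notation N := ((2 * n).+2).
Local Notation q := (r^-1 * s).
Local Notation h := (rh^-1 * sh).
Local Notation ecol := (@ecol F n).
Local Notation ecol2 := (@ecol2 F n).

Lemma e0_ecol (z : F) k : in_range n k ->
  e_mx n r s rh sh th z 0 *m ecol k =
  (- (rh^-1 * sh ^- 3 * z)) *:
    ((k == 2)%N%:R *: ecol (p 1) - (r * s * (k == 1)%N%:R) *: ecol (p 2)).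
Proof.
move=> kN; rewrite /e_mx /= -scalemxAl mulmxBl -scalemxAl !E_ecol //.
by rewrite ![_ == k]eq_sym scalerA.
Qed.

Lemma sum_E_ecol a b k : in_range n k ->
  (\sum_(a <= j < b) E n j j) *m ecol k = (a <= k < b)%:R *: ecol k.
Proof.
move=> kN; rewrite mulmx_suml (eq_bigr (fun j => if j == k then ecol k else 0)).
  rewrite -big_mkcond big_nat1_eq.
  by case: ifP => _; rewrite ?scale1r ?scale0r.
move=> j _; rewrite E_ecol //.
by case: eqP => [->|_]; rewrite ?scale1r ?scale0r.
Qed.

Lemma omega0_prim1 : omega_mx n r s 0 *m ecol (p 1) = s ^- 2 *: ecol (p 1).
Proof.
have kN : in_range n (p 1) by rewrite /in_range /prim; lia.
rewrite /omega_mx /= !mulmxDl -!scalemxAl !sum_E_ecol // !E_ecol // eqxx.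
have -> : (1 == p 1)%N = false by rewrite /prim; lia.
have -> : (2 == p 1)%N = false by rewrite /prim; lia.
have -> : (3 <= p 1 < n.+1)%N = false by rewrite /prim; lia.
have -> : (n.+1 == p 1)%N = false by rewrite /prim; lia.
have -> : (p 2 == p 1)%N = false by rewrite /prim; lia.
have -> : (p n <= p 1 < (p 3).+1)%N = false by rewrite /prim; lia.
by rewrite /= !scale0r !scaler0 !(add0r, addr0) scale1r.
Qed.

Lemma omega0_prim2 : omega_mx n r s 0 *m ecol (p 2) = r ^+ 2 *: ecol (p 2).
Proof.
have kN : in_range n (p 2) by rewrite /in_range /prim; lia.
rewrite /omega_mx /= !mulmxDl -!scalemxAl !sum_E_ecol // !E_ecol // eqxx.
have -> : (1 == p 2)%N = false by rewrite /prim; lia.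
have -> : (2 == p 2)%N = false by rewrite /prim; lia.
have -> : (3 <= p 2 < n.+1)%N = false by rewrite /prim; lia.
have -> : (n.+1 == p 2)%N = false by rewrite /prim; lia.
have -> : (p 1 == p 2)%N = false by rewrite /prim; lia.
have -> : (p n <= p 2 < (p 3).+1)%N = false by rewrite /prim; lia.
by rewrite /= !scale0r !scaler0 !(add0r, addr0) scale1r.
Qed.

Definition e0_tens (z w : F) : 'M[F]_((2 * n).+1 * (2 * n).+1) :=
  e_mx n r s rh sh th z 0 *t 1%:M
  + omega_mx n r s 0 *t e_mx n r s rh sh th w 0.

(** Since e_0 only moves v_1 and v_2, only k = 1, 2, 1', 2' contribute. For the last two, omega_0
    acts on the left factor by s^-2 and r^2 respectively. *)
Lemma e0_tens_ecol2 (z w : F) k : in_range n k ->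
  e0_tens z w *m ecol2 k (p k) = (- (rh^-1 * sh ^- 3)) *:
    (z *: ((k == 2)%N%:R *: ecol2 (p 1) (p k)
           - (r * s) *: ((k == 1)%N%:R *: ecol2 (p 2) (p k)))
     + w *: (r ^+ 2 *: ((k == p 2)%:R *: ecol2 k (p 1))
             - (r * s * s ^- 2) *: ((k == p 1)%:R *: ecol2 k (p 2)))).
Proof.
move=> kN; rewrite mulmxDl /ecol2 !tensmx_mul mul1mx !e0_ecol ?prim_range //.
rewrite tensmxZl tensmxBl !tensmxZl tensmxZr tensmxBr !tensmxZr !prim_eq //;
  try by rewrite /in_range; lia.
rewrite [RHS]scalerDr; congr (_ + _).
  move: (_ *t _) (_ *t _) => X Y; apply/matrixP=> i j; rewrite !mxE; ring.
have [->|k2] := eqVneq k (p 2).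
  have -> : (p 2 == p 1) = false by rewrite /prim; lia.
  rewrite omega0_prim2 !tensmxZl.
  move: (_ *t _) (_ *t _) => X Y; apply/matrixP=> i j; rewrite !mxE /=; ring.
have [->|k1] := eqVneq k (p 1).
  rewrite omega0_prim1 !tensmxZl.
  move: (_ *t _) (_ *t _) => X Y; apply/matrixP=> i j; rewrite !mxE /=; ring.
by rewrite !(mulr0, scale0r, scaler0, subr0).
Qed.

(** Both summands of the coproduct send omega to multiples of u: k = 1, 2 give the term in z and k =
    1', 2' the term in w. *)
Lemma e0_tens_inv_vec (z w : F) :
  e0_tens z w *m inv_vec n rh sh =
  (- (rh^-1 * sh ^- 3) * (h ^+ (2 * n))^-1 * (z * (q ^+ (2 * n) / q) - w))
    *: alt_vec n r s rh sh.
Proof.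
have rh0 : rh != 0 by move: r0; rewrite -rhE expf_eq0.
have sh0 : sh != 0 by move: s0; rewrite -shE expf_eq0.
have h0 : h != 0 by rewrite mulf_neq0 ?invr_eq0.
have R1 : in_range n 1 by rewrite /in_range; lia.
have R2 : in_range n 2 by rewrite /in_range; lia.
pose t k := h ^ rho2 n k.
have tS (c : nat) (G : nat -> 'M[F]_((2 * n).+1 * (2 * n).+1, 1 * 1)) : in_range n c ->
    \sum_(1 <= k < N) t k *: ((k == c)%:R *: G k) = t c *: G c.
  move=> cN; transitivity
    (\sum_(1 <= k < N) ((k == c) && xpredT k)%:R *: (t k *: G k)).
    by apply: eq_bigr => j _; rewrite !scalerA andbT mulrC.
  by rewrite sum_nat_delta //= scale1r.
transitivity ((- (rh^-1 * sh ^- 3)) *: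
    (z *: (t 2 *: ecol2 (p 1) (p 2) - (r * s) *: (t 1 *: ecol2 (p 2) (p 1)))
     + w *: (r ^+ 2 *: (t (p 2) *: ecol2 (p 2) (p 1))
             - (r * s * s ^- 2) *: (t (p 1) *: ecol2 (p 1) (p 2))))).
  rewrite -(tS 2%N (fun k => ecol2 (p 1) (p k))) //.
  rewrite -(tS 1%N (fun k => ecol2 (p 2) (p k))) //.
  rewrite -(tS (p 2) (fun k => ecol2 k (p 1))) ?prim_range //.
  rewrite -(tS (p 1) (fun k => ecol2 k (p 2))) ?prim_range //.
  rewrite !scaler_sumr -!sumrB !scaler_sumr -big_split scaler_sumr.
  rewrite mulmx_sumr; apply: eq_big_nat => k kN.
  rewrite -scalemxAr e0_tens_ecol2 //= -/(t k).
  move: (t k) (ecol2 _ _) (ecol2 _ _) (ecol2 _ _) (ecol2 _ _) => u X Y Z W.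
  by apply/matrixP=> i j; rewrite !mxE; ring.
(* As 2 rho_1 = 2n-1 and 2 rho_2 = 2n-3, the power h^(2n) is split off and then generalised, leaving
   fixed exponents for [field]. *)
have t2n k m : rho2 n k = (2 * n)%:Z + m -> t k = h ^+ (2 * n) * h ^ m.
  by rewrite /t => ->; rewrite expfzDr.
rewrite /t !rho2_prim // -/(t 1) -/(t 2) -!invr_expz -/(t 1) -/(t 2).
have -> : t 2 = h ^+ (2 * n) * h ^ (-3).
  by apply: t2n; rewrite /rho2 ifT //; lia.
have -> : t 1 = h ^+ (2 * n) * h ^ (-1).
  by apply: t2n; rewrite /rho2 ifT //; lia.
have qh : q = h ^+ 2 by rewrite -rhE -shE -exprVn -exprMn.
rewrite qh exprAC -[h ^ (-3)]/(h ^- 3) exprN1 /alt_vec.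
have : h ^+ (2 * n) != 0 by rewrite expf_neq0.
move: (ecol2 _ _) (ecol2 _ _) (h ^+ (2 * n)) => X Y H H0; rewrite -rhE -shE.
by apply/matrixP=> i j; rewrite !mxE; field; rewrite rh0 sh0.
Qed.

End Raising.

(** * Eigenvalues of R_new *)

(* The numerator of R_new acts by this scalar on an eigenvector of R for the
   eigenvalue [a], with [Q] standing for q^(2n).  The flag [b] tells whether R is
   invertible: otherwise [invmx R] is R itself, and rather than excluding this
   case we show that the argument survives it. *)
Definition baxter_value (F : fieldType) (q Q x a : F) (b : bool) : F :=
  q^-1 * x * (x - 1) * a
  + (1 + q^-1 / (- q) + q^-1 / Q + q^-1 ^+ 2 / (- q * Q)) * x
  - q^-1 / (- q * Q) * (x - 1) * (if b then a^-1 else a).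

(** * Inequalities between eigenvalues, from the transcendence of w/z *)

Section BaxterValue.

Variables (K F : fieldType) (phi : {rmorphism K -> F}) (q Q : K) (z w : F).
Hypothesis quadratic : forall a b c : K,
  phi a * z ^+ 2 + phi b * z * w + phi c * w ^+ 2 = 0 -> c = 0.
Hypotheses (z0 : z != 0) (q0 : q != 0) (Q0 : Q != 0).

Local Notation x := (z / w)^-1.

Lemma transc_neq0 : w != 0.
Proof.
apply/eqP => w0; case/eqP: (oner_neq0 K); apply: (@quadratic 0 0).
by rewrite w0 rmorph0; ring.
Qed.

Lemma transc_neq : w - z != 0.
Proof.
apply/eqP => wz; case/eqP: (oner_neq0 K); apply: (@quadratic 0 (-1)).
transitivity (w * (w - z)); last by rewrite wz mulr0.
by rewrite rmorph0 rmorphN rmorph1; ring.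
Qed.

(** This is the normalising coefficient. Here x = w/z, and multiplication by z^2 gives a quadratic
    form in z and w whose w^2 coefficient is 1. *)
Lemma baxter_value_neq0 b : baxter_value (phi q) (phi Q) x (phi q) b != 0.
Proof.
have fq0 : phi q != 0 by rewrite fmorph_eq0.
have fQ0 : phi Q != 0 by rewrite fmorph_eq0.
have w0 := transc_neq0.
apply/eqP => bv0; case/eqP: (oner_neq0 K); apply: (@quadratic
  (if b then - (q^+3 * Q)^-1 else - (q * Q)^-1)
  (if b then - (q^+2)^-1 + (q * Q)^-1 else
     (1 - (q^+2)^-1) * (1 + (q * Q)^-1) - 1 + (q * Q)^-1)).
transitivity (z ^+ 2 * 0); last by ring.
rewrite -bv0 /baxter_value; case: b {bv0};
  rewrite !(rmorphD, rmorphB, rmorphN, rmorphM, rmorph1, fmorphV, rmorphXn) /=;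
  by field; rewrite ?oppr_eq0 ?oner_neq0 fq0 fQ0 w0 z0.
Qed.

(** The two sides are the cross-multiplied form of the ratio that intertwining would impose on the
    eigenvalues at u and omega. Their difference factors, and each factor is nonzero. *)
Lemma baxter_value_neq b :
  q ^+ 3 * Q - 1 != 0 -> q * Q - 1 != 0 -> q ^+ 2 + 1 != 0 ->
  Q + q != 0 ->
  baxter_value (phi q) (phi Q) x (- (phi q)^-1) b
    * (z * (phi Q / phi q) - w) !=
  baxter_value (phi q) (phi Q) x (phi Q)^-1 b * (w * (phi Q / phi q) - z).
Proof.
move=> n1 n2 n3 n4.
have fq0 : phi q != 0 by rewrite fmorph_eq0.
have fQ0 : phi Q != 0 by rewrite fmorph_eq0.
have w0 := transc_neq0; have wz := transc_neq.
rewrite -subr_eq0 /baxter_value; case: b.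
  set t := (X in X != 0).
  have -> : t = - (phi ((q * Q - 1) * (q ^+ 2 + 1) * (Q + q) / (q ^+ 4 * Q))
     * w * (w - z) / z); last first.
    rewrite oppr_eq0 !mulf_neq0 ?invr_eq0 // fmorph_eq0.
    by rewrite !mulf_neq0 ?invr_eq0 ?mulf_neq0 ?expf_neq0.
  rewrite /t !(rmorphD, rmorphB, rmorphN, rmorphM, rmorph1, fmorphV, rmorphXn) /=.
  by field; rewrite ?oppr_eq0 ?oner_neq0 fq0 fQ0 w0 z0.
(* For singular R the difference has a factor linear in z and w; its w coefficient is nonzero
   because q^3 Q differs from 1. *)
pose u := - phi (1 - (q ^+ 3 * Q)^-1) * w
  - phi (- (q * Q)^-1 * (- (q ^+ 2)^-1 + (q * Q)^-1)) * z.
have u0 : u != 0.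
  apply/eqP => u0; have := @quadratic 0
    (- (- (q * Q)^-1 * (- (q ^+ 2)^-1 + (q * Q)^-1))) (- (1 - (q ^+ 3 * Q)^-1)) _.
  move=> ne; move/eqP: n1; apply; have q3 : q ^+ 3 * Q != 0.
    by rewrite mulf_neq0 ?expf_neq0.
  have -> : q ^+ 3 * Q - 1 = - (q ^+ 3 * Q) * (- (1 - (q ^+ 3 * Q)^-1)).
    by field; rewrite q0 Q0.
  rewrite ne ?mulr0 //; transitivity (u * w); last by rewrite u0 mul0r.
  by rewrite /u rmorph0 !rmorphN; ring.
set t := (X in X != 0).
have -> : t = phi ((Q + q) / q) * (w - z) / z * u; last first.
  rewrite !mulf_neq0 ?invr_eq0 // fmorph_eq0.
  by rewrite mulf_neq0 ?invr_eq0.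
rewrite /t /u !(rmorphD, rmorphB, rmorphN, rmorphM, rmorph1, fmorphV, rmorphXn) /=.
by field; rewrite ?oppr_eq0 ?oner_neq0 fq0 fQ0 w0 z0.
Qed.

End BaxterValue.

Section RnewSpectrum.

Variables (F : fieldType) (n : nat) (r s rh sh : F).
Hypotheses (n_gt2 : (2 < n)%N) (rhE : rh ^+ 2 = r) (shE : sh ^+ 2 = s).
Hypotheses (r0 : r != 0) (s0 : s != 0).

Local Notation R := (braidR n r s rh sh).
Local Notation q := (r^-1 * s).
Local Notation Q := (q ^+ (2 * n)).

Let rsV : r * s^-1 = q^-1. Proof. by rewrite invfM invrK. Qed.

Lemma invmx_eigen m k (A : 'M[F]_m) (v : 'M[F]_(m, k)) a :
  A *m v = a *: v -> a != 0 ->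
  invmx A *m v = (if A \in unitmx then a^-1 else a) *: v.
Proof.
move=> Av a0; case: ifP => [uA|/negbT uA]; last by rewrite /invmx (negbTE uA).
apply: (can_inj (scalerK a0)).
by rewrite scalemxAr -Av mulKmx // scalerA divff // scale1r.
Qed.

(** Convertible to the matrix M inside [Rnew], a fact on which [Rnew_eigen] relies. *)
Definition baxter_num (x : F) :=
  let S := invmx R in
  let l1 := r * s^-1 in
  let l2 := - (r^-1 * s) in
  let l3 := (r^-1 * s) ^+ (2 * n) in
  (l1 * x * (x - 1)) *: invmx S
  + ((1 + l1 / l2 + l1 / l3 + l1 ^+ 2 / (l2 * l3)) * x) *: 1%:M
  - (l1 / (l2 * l3) * (x - 1)) *: S.

Lemma baxter_num_eigen m x (v : 'M[F]_(_, m)) a : R *m v = a *: v -> a != 0 ->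
  baxter_num x *m v = baxter_value q Q x a (R \in unitmx) *: v.
Proof.
move=> Rv a0; rewrite /baxter_num invmxK !(mulmxDl, mulNmx) -!scalemxAl.
(* By [invmxK] the inverse of S is already R here, even when R is singular. *)
rewrite Rv (invmx_eigen Rv a0) mul1mx !scalerA -scalerDl -scalerBl.
by rewrite rsV.
Qed.

Lemma ecol2_coef i j (a b : 'I_((2 * n).+1)) :
  ecol2 F n i j (mxtens_index (a, b)) (mxtens_index (0, 0))
  = ((a.+1 == i) && (b.+1 == j))%:R.
Proof. by rewrite /ecol2 tensmxE !mxE -natrM mulnb. Qed.

(** As v_1 (x) v_1 is both a basis vector and an eigenvector, its diagonal entry is the
    eigenvalue. *)
Lemma baxter_num11 x :
  let k11 := mxtens_index (ord0, ord0) in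
  baxter_num x k11 k11 = baxter_value q Q x q (R \in unitmx).
Proof.
move=> k11; have q0 : q != 0 by rewrite mulf_neq0 ?invr_eq0.
have Rv : R *m ecol2 F n 1 1 = q *: ecol2 F n 1 1.
  exact: (braidR_ecol11 (ltnW n_gt2) rhE shE r0 s0).
move: (baxter_num x) (baxter_num_eigen x Rv q0) => M.
move/matrixP/(_ k11 (mxtens_index (0, 0))).
rewrite mxE (bigD1 k11) //= big1 ?addr0 => [|k].
  by rewrite [X in _ = X -> _]mxE /k11 !ecol2_coef /= !mulr1.
case: (mxtens_indexP k) => a b ne; rewrite ecol2_coef.
case: eqP => [a0|_] /=; last by rewrite mulr0.
case: eqP => [b0|_] /=; last by rewrite mulr0.
case/eqP: ne; rewrite /k11; congr (mxtens_index (_, _)); apply: val_inj => /=; lia.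
Qed.

Lemma Rnew_eigen m z (v : 'M[F]_(_, m)) a : R *m v = a *: v -> a != 0 ->
  Rnew n r s rh sh z *m v =
  ((baxter_value q Q z^-1 q (R \in unitmx))^-1
   * baxter_value q Q z^-1 a (R \in unitmx)) *: v.
Proof.
move=> Rv a0; transitivity
  ((baxter_num z^-1 (mxtens_index (ord0, ord0)) (mxtens_index (ord0, ord0)))^-1
     *: baxter_num z^-1 *m v); first by [].
by rewrite -scalemxAl (baxter_num_eigen _ Rv a0) baxter_num11 scalerA.
Qed.

Lemma alt_vec_neq0 : alt_vec n r s rh sh != 0.
Proof.
apply/eqP => /matrixP.
(* These ordinals stand for 1' = 2n+1 and 2' = 2n; the entry of u there is h^-1. *)
have i1 : (2 * n < (2 * n).+1)%N by [].
have i2 : ((2 * n).-1 < (2 * n).+1)%N by lia.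
move/(_ (mxtens_index (Ordinal i1, Ordinal i2)) (mxtens_index (0, 0))).
have entryB m k (A B : 'M[F]_(m, k)) a b i j :
    (a *: A - b *: B) i j = a * A i j - b * B i j by rewrite !mxE.
rewrite entryB !ecol2_coef mxE /=.
have -> : ((2 * n).+1 == prim n 1) && ((2 * n).-1.+1 == prim n 2).
  by rewrite /prim; lia.
have -> : ((2 * n).+1 == prim n 2) && ((2 * n).-1.+1 == prim n 1) = false.
  by rewrite /prim; lia.
rewrite mulr0 subr0 mulr1 => /eqP; rewrite invr_eq0 mulf_eq0 invr_eq0.
have := r0; have := s0; rewrite -rhE -shE !expf_eq0 /=.
by move=> /negbTE-> /negbTE->.
Qed.

(** Both sides are multiples of u. On the left R_new meets u, on the right it meets omega, and z and
    w are exchanged in the factor coming from e_0. *)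
Lemma Rnew_e0_tens_neq th z w :
  baxter_value q Q (z / w)^-1 q (R \in unitmx) != 0 ->
  baxter_value q Q (z / w)^-1 (- q^-1) (R \in unitmx) * (z * (Q / q) - w)
    != baxter_value q Q (z / w)^-1 Q^-1 (R \in unitmx) * (w * (Q / q) - z) ->
  Rnew n r s rh sh (z / w) *m (e0_tens n r s rh sh th z w *m inv_vec n rh sh)
  <> e0_tens n r s rh sh th w z *m (Rnew n r s rh sh (z / w) *m inv_vec n rh sh).
Proof.
move=> c0 /eqP neq.
have rh0 : rh != 0 by move: r0; rewrite -rhE expf_eq0.
have sh0 : sh != 0 by move: s0; rewrite -shE expf_eq0.
have q0 : q != 0 by rewrite mulf_neq0 ?invr_eq0.
rewrite (Rnew_eigen _ (braidR_inv_vec (ltnW n_gt2) rhE shE r0 s0));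
  last by rewrite invr_eq0 expf_neq0.
rewrite -scalemxAr !e0_tens_inv_vec // -scalemxAr.
rewrite (Rnew_eigen _ (braidR_alt_vec (ltnW n_gt2) rhE shE r0 s0));
  last by rewrite oppr_eq0 invr_eq0.
rewrite !scalerA => /eqP; rewrite -subr_eq0 -scalerBl scaler_eq0.
rewrite (negbTE alt_vec_neq0) orbF subr_eq0 => /eqP eqc; apply: neq.
move: c0 eqc.
move: (baxter_value _ _ _ _ _) (baxter_value _ _ _ _ _) (baxter_value _ _ _ _ _).
move=> m3 m2 c c0 eqc.
set u := z * (Q / q) - w in eqc *; set u' := w * (Q / q) - z in eqc *.
(* The factor common to both scalars: the constant of e_0 on omega times the normalisation. *)
have k0 : - (rh^-1 * sh ^- 3) * ((rh^-1 * sh) ^+ (2 * n))^-1 * c^-1 != 0.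
  by rewrite !(mulf_eq0, invr_eq0, oppr_eq0, expf_eq0) (negbTE rh0) (negbTE sh0)
    (negbTE c0) !andbF.
apply: (mulfI k0); move: (- _ * _^-1) eqc => k eqc.
transitivity (k * u * (c^-1 * m2)); first by ring.
by rewrite eqc; ring.
Qed.

End RnewSpectrum.

(** * Failure of the intertwining property *)

Theorem proposition4p17 (K : fieldType) (r s rh sh th : K) (n : nat)
    (charK : [pchar K] =i pred0)
    (rs_indep : alg_indep2 r s)
    (rhE : rh ^+ 2 = r) (shE : sh ^+ 2 = s) (thE : th ^+ 2 = r + s)
    (n_ge3 : (3 <= n)%N)
    (U : affine_algebra K n)
    (Tz Tw : {rmorphism U -> 'M[ratfun2 K]_((2 * n).+1)})
    (TzP : is_minimal_affinization r s rh sh th (ratfun2z K) Tz)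
    (TwP : is_minimal_affinization r s rh sh th (ratfun2w K) Tw)
    (Tzw Twz : {rmorphism aff_alg2 U ->
                  'M[ratfun2 K]_((2 * n).+1 * (2 * n).+1)})
    (TzwP : is_tensor_rep Tz Tw Tzw)
    (TwzP : is_tensor_rep Tw Tz Twz) :
  let Rzw := Rnew n (ratfun2C r) (ratfun2C s) (ratfun2C rh) (ratfun2C sh)
               (ratfun2z K / ratfun2w K) in
  exists (x : U) (i j : 'I_((2 * n).+1)),
    Rzw *m Tzw (Delta U x) *m (basis_vec (ratfun2 K) i *t basis_vec _ j)
    <> Twz (Delta U x) *m Rzw *m (basis_vec (ratfun2 K) i *t basis_vec _ j).
Proof.
move=> Rzw; set z := ratfun2z K; set w := ratfun2w K.
have [r0 s0] := alg_indep2_neq0 rs_indep.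
pose q := r^-1 * s; pose Q := q ^+ (2 * n).
have q0 : q != 0 by rewrite mulf_neq0 ?invr_eq0.
have Cr0 : ratfun2C r != 0 by rewrite fmorph_eq0.
have Cs0 : ratfun2C s != 0 by rewrite fmorph_eq0.
have Crh : ratfun2C rh ^+ 2 = ratfun2C r by rewrite -rmorphXn rhE.
have Csh : ratfun2C sh ^+ 2 = ratfun2C s by rewrite -rmorphXn shE.
have qX k : (0 < k)%N -> q ^+ k - 1 != 0.
  by move=> k0; rewrite subr_eq0; exact: alg_indep2_expn_neq1.
(* If q^k = -1, then q^(2k) = 1. *)
have qXN k : (0 < k)%N -> q ^+ k + 1 != 0.
  move=> k0; have := qX (k * 2)%N; rewrite muln_gt0 k0 => /(_ isT).
  by apply: contra => /eqP/addr0_eq e; rewrite exprM -[q ^+ k]opprK e sqrrN expr1n subrr.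
have CqE : (ratfun2C r)^-1 * ratfun2C s = ratfun2C q by rewrite /q rmorphM fmorphV.
have CQE : ratfun2C q ^+ (2 * n) = ratfun2C Q by rewrite /Q rmorphXn.
have Q0 : Q != 0 by rewrite expf_neq0.
have := Rnew_e0_tens_neq n_ge3 Crh Csh Cr0 Cs0 (th := ratfun2C th) (z := z) (w := w).
rewrite CqE CQE -/Rzw => neq.
have quad (a b c : K) := @ratfun2w_quadratic K a b c.
have n1 : q ^+ 3 * Q - 1 != 0 by rewrite -exprD; exact: qX.
have n2 : q * Q - 1 != 0 by rewrite -exprS; exact: qX.
have n3 : q ^+ 2 + 1 != 0 by exact: qXN.
have n4 : Q + q != 0.
  have -> : Q + q = q * (q ^+ (2 * n).-1 + 1).
    by rewrite mulrDr mulr1 -exprS prednK // muln_gt0; lia.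
  by rewrite mulf_neq0 ?qXN //; lia.
have z0 := ratfun2z_neq0 K.
have {}neq := neq (baxter_value_neq0 quad z0 q0 Q0 _)
  (baxter_value_neq quad z0 q0 Q0 _ n1 n2 n3 n4).
move: Rzw neq => Rzw neq; exists (ge U ord0).
have eD (T1 T2 : {rmorphism U -> 'M[ratfun2 K]_((2 * n).+1)}) u1 u2
    (T12 : {rmorphism aff_alg2 U -> 'M[ratfun2 K]_((2 * n).+1 * (2 * n).+1)}) :
    is_minimal_affinization r s rh sh th u1 T1 ->
    is_minimal_affinization r s rh sh th u2 T2 ->
    is_tensor_rep T1 T2 T12 ->
    T12 (Delta U (ge U ord0)) = e0_tens n (ratfun2C r) (ratfun2C s)
      (ratfun2C rh) (ratfun2C sh) (ratfun2C th) u1 u2.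
  move=> [_ [e1 _ o1 _ _]] [_ [e2 _ _ _ _]] T12P.
  by rewrite Delta_e rmorphD !T12P /= e1 e2 o1 rmorph1.
rewrite (eD _ _ _ _ _ TzP TwP TzwP) (eD _ _ _ _ _ TwP TzP TwzP).
set X := e0_tens _ _ _ _ _ _ _ _ in neq *.
set X' := e0_tens _ _ _ _ _ _ _ _ in neq *.
(* The pair of basis vectors is not exhibited: if the two operators agreed on all pairs, they would
   agree on omega by linearity. *)
have [ex|noex] := boolP [exists i, exists j,
   Rzw *m X *m (basis_vec (ratfun2 K) i *t basis_vec _ j)
   != X' *m Rzw *m (basis_vec (ratfun2 K) i *t basis_vec _ j)].
  by case/existsP: ex => i /existsP[j /eqP ne]; exists i, j.
case: neq; rewrite !mulmxA; rewrite /inv_vec !mulmx_sumr.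
apply: eq_big_nat => k kN; rewrite -!scalemxAr; congr (_ *: _).
have ecolE l : in_range n l -> exists i : 'I_((2 * n).+1),
    ecol (ratfun2 K) n l = basis_vec _ i.
  case/andP=> l0 lN; have l1 : (l.-1 < (2 * n).+1)%N by lia.
  exists (Ordinal l1); apply/matrixP => a b; rewrite !mxE ord1 eqxx andbT.
  by congr (_%:R); rewrite -val_eqE /=; lia.
rewrite /ecol2; have [i ->] := ecolE _ kN; have [j ->] := ecolE _ (prim_range kN).
move: noex; rewrite negb_exists => /forallP/(_ i).
by rewrite negb_exists => /forallP/(_ j); rewrite negbK => /eqP.
Qed.
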